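(* Let $(J,P)$ be a finite tournament. (a) There exists an arc cyclic, prime tournament $(X,R)$ with $X$ countably infinite and with finitely many non-isolated points such that the restriction $(F,R|F)$ to the set $F$ of non-isolated points is isomorphic to $(J,P)$. (b) There exists an arc cyclic, prime tournament $(X,R)$ such that $X$ contains a Cantor subset $C$ and countably many isolated points; the set $F$ of limit points of the set of isolated points is finite and contained in $C$; and the restriction $(F,R|F)$ is isomorphic to $(J,P)$. (c) There exists an arc cyclic, prime tournament $(X,R)$ such that $X$ contains a Cantor subset $C$ and countably many isolated points; each of the limit points of the set of isolated points is contained in $C$; the set $F$ of limit points of the set of isolated points is countably infinite; and the restriction $(F,R|F)$ is isomorphic to $N_1=(\mathbb N^*,L_1)$. (d) There exists an almost locally arc cyclic, wac, prime tournament $(X,R)$ with $X$ a Cantor set such that the restriction $(F,R|F)$ to the set $F$ of exceptional points is isomorphic to $(J,P)$.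
   Context: All spaces are Hausdorff. A tournament on a nonempty set $X$ is a relation $R\subset X\times X$ with $R\cap R^{-1}=1_X$ (the diagonal) and $R\cup R^{-1}=X\times X$; $R^\circ=R\setminus1_X$; $R|A=R\cap(A\times A)$; write $x\rightharpoonup y$ for $(x,y)\in R^\circ$. It is topological if $R$ is closed in $X\times X$. A 3-cycle is $\{x_1,x_2,x_3\}$ with $x_1\rightharpoonup x_2\rightharpoonup x_3\rightharpoonup x_1$. The tournament is arc cyclic if every arc is contained in a 3-cycle. A cycle point is a point each of whose neighborhoods contains a 3-cycle including it. A wac tournament is a compact topological tournament in which every non-isolated point is a cycle point. A subset $B\subset X$ is an arc cyclic subset if every arc $(x_1,x_2)\in R^\circ$ with $x_1,x_2\in B$ is contained in a 3-cycle $\{x_1,x_2,x_3\}$ of $X$ ($x_3$ need not be in $B$). An exceptional point is a point having no neighborhood which is an arc cyclic subset; $(X,R)$ is almost locally arc cyclic if it has only finitely many exceptional points. A quotient map $h:(X_2,R_2)\to(X_1,R_1)$ of compact topological tournaments is a continuous surjection with $(h\times h)(R_2)\subset R_1$; it is an isomorphism if injective. A prime tournament is a compact topological tournament with more than one point whose only quotient maps onto tournaments with more than one point are isomorphisms. $\mathbb N^*=\mathbb N\cup\{\infty\}$ is the one-point compactification of $\mathbb N$, and $L_1$ is the tournament on $\mathbb N^*$ with $i+1\rightharpoonup i$ for $i\in\mathbb N$ and $i\rightharpoonup j$ whenever $i+1<j\le\infty$. *)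

(* Defs.v *)
From mathcomp Require Import all_boot all_classical.
From mathcomp Require Import reals topology cantor.

Set Implicit Arguments.
Unset Strict Implicit.
Unset Printing Implicit Defensive.

Local Open Scope classical_set_scope.
Local Open Scope relation_scope.

Definition tournament (X : Type) (R : set (X * X)) : Prop :=
  [/\ [set: X] !=set0, R `&` R^-1 = diagonal & R `|` R^-1 = setT].

(* [strict R] is R° : the pair (x, y) is an arc when [strict R (x, y)]. *)
Definition strict (X : Type) (R : set (X * X)) : set (X * X) := R `\` diagonal.

Definition three_cycle (X : Type) (R : set (X * X)) (A : set X) : Prop :=
  exists x1 x2 x3, A = [set x1; x2; x3] /\
    [/\ strict R (x1, x2), strict R (x2, x3) & strict R (x3, x1)].

Definition arc_cyclic (X : Type) (R : set (X * X)) : Prop :=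
  forall x y, strict R (x, y) ->
    exists2 A, three_cycle R A & [set x; y] `<=` A.

(* The third vertex of the 3-cycle is not required to lie in B. *)
Definition arc_cyclic_subset (X : Type) (R : set (X * X)) (B : set X) : Prop :=
  forall x1 x2, B x1 -> B x2 -> strict R (x1, x2) ->
    exists x3, three_cycle R [set x1; x2; x3].

(* R|A, as a relation on the subtype of A; this subtype carries the subspace
   topology whenever X is a topological space. *)
Definition restr (X : Type) (R : set (X * X)) (A : set X) : set (A * A) :=
  [set p | R (set_val p.1, set_val p.2)].

Definition compact_tournament (X : topologicalType) (R : set (X * X)) : Prop :=
  [/\ hausdorff_space X, compact [set: X], tournament R & closed R].

Definition quotient_map (X2 X1 : topologicalType)
    (R2 : set (X2 * X2)) (R1 : set (X1 * X1)) (h : X2 -> X1) : Prop :=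
  [/\ continuous h, range h = [set: X1]
    & [set (h p.1, h p.2) | p in R2] `<=` R1].

(* Between compact Hausdorff tournaments the inverse of such a map is
   automatically continuous, and it preserves the relation. *)
Definition isomorphism (X2 X1 : topologicalType)
    (R2 : set (X2 * X2)) (R1 : set (X1 * X1)) (h : X2 -> X1) : Prop :=
  quotient_map R2 R1 h /\ injective h.

Definition isomorphic (X2 X1 : topologicalType)
    (R2 : set (X2 * X2)) (R1 : set (X1 * X1)) : Prop :=
  exists h : X2 -> X1, isomorphism R2 R1 h.

Definition nontrivial (X : Type) : Prop := exists x y : X, x <> y.

Definition prime_tournament (X : topologicalType) (R : set (X * X)) : Prop :=
  [/\ compact_tournament R, nontrivial X &
      forall (Y : topologicalType) (S : set (Y * Y)) (h : X -> Y),
        compact_tournament S -> nontrivial Y ->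
        quotient_map R S h -> isomorphism R S h].

Definition cycle_point (X : topologicalType) (R : set (X * X)) (x : X) : Prop :=
  forall U, nbhs x U -> exists A, [/\ three_cycle R A, A x & A `<=` U].

Definition isolated_points (X : topologicalType) : set X :=
  isolated [set: X].

Definition wac (X : topologicalType) (R : set (X * X)) : Prop :=
  compact_tournament R /\ forall x, ~ isolated_points x -> cycle_point R x.

Definition exceptional_points (X : topologicalType) (R : set (X * X)) : set X :=
  [set x | ~ exists2 U, nbhs x U & arc_cyclic_subset R U].

Definition almost_locally_arc_cyclic
    (X : topologicalType) (R : set (X * X)) : Prop :=
  finite_set (exceptional_points R).

Definition homeomorphic (X Y : topologicalType) : Prop :=
  exists (f : X -> Y) (g : Y -> X),
    [/\ continuous f, continuous g, cancel f g & cancel g f].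

(* [cantor_like] is not used for this: it does not imply metrizability. *)
Definition is_cantor (X : topologicalType) : Prop :=
  homeomorphic X cantor_space.

Definition cantor_subset (X : topologicalType) (C : set X) : Prop :=
  is_cantor C.

(* The point [None] is the point at infinity. *)
Definition Nstar : topologicalType := one_point_compactification nat.

Definition L1_arc (x y : option nat) : Prop :=
  match x, y with
  | Some i, Some j => i = (j + 1)%N \/ (i + 1 < j)%N
  | Some _, None => True
  | None, _ => False
  end.

Definition L1 : set (Nstar * Nstar) := [set p | p.1 = p.2 \/ L1_arc p.1 p.2].

(* Main.v *)
Require Import Defs.
From mathcomp Require Import all_boot all_classical.
From mathcomp Require Import reals topology cantor.

(** Everything is built from small tournaments that carry a locally constant sign
such that each vertex has, among its successors as well as among its predecessors,
a partner of the opposite sign ([signed]).  Put copies of them side by side as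
fibres and twist the arcs between two fibres: let such an arc be reversed when the
sign of one end changes.  Then both properties to be proved come from the same
remark.

Arc cyclicity: given an arc x -> y between two fibres, choose a partner x' -> x;
the twist gives y -> x'.

Primality: a fibre of a quotient map is a module, that is, a set whose vertices
have the same direction towards every outside vertex ([prime_rel_of]).  A module
that meets two fibres must contain a partner of one of its points, hence both
signs in one fibre; the points of the other fibres separate the two signs, so they
are in the module too, and it spreads to the whole space.  A module inside one
fibre is separated from outside as soon as it contains both signs.  So for the
levels of the towers below it is enough that their modules of constant sign be
points and, for arc cyclicity, that their arcs of constant sign lie in 3-cycles.

Two arrangements of fibres are used.  The twisted product puts one simple fibre over
each vertex of a finite tournament ([prod_cyclic], [prod_simple]).  The tower is a
sequence of levels converging to a new point; a point of level n looks at all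
levels beyond n + 1 and at the limit according to its own sign only, so the arcs
converge, while consecutive levels are twisted ([tower_cyclic], [tower_simple]).
A tower has again a sign for which its vertices have partners ([tower_signed]),
and its limit is positive; so in a product of towers over P, or in a tower of
towers, the limits of the inner towers span P, or the tournament [L1].

The four parts differ in the levels of the inner towers: (a) four points; (b) and
(c) a Cantor tournament and an isolated point; (d) two copies of the Cantor
tournament joined without twist, so that arcs outside all 3-cycles occur on every
level and the limits become exceptional.  The Cantor tournament compares two binary
sequences at their first difference and twists the result by their next letters,
which makes each of its cylinders a twisted product ([cantor_signed],
[cantor_cyclic_local], [cantor_sign_simple]). *)

Set Implicit Arguments.
Unset Strict Implicit.
Unset Printing Implicit Defensive.

Local Open Scope classical_set_scope.
Local Open Scope card_scope.

(** * Boolean orientations and modules *)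

(** Openness of the arc set carries the topology of a tournament: it makes
[rel_of c] closed and, since [c] is irreflexive, it separates points
(Lemma [orientation_hausdorff]). *)
Record orientation (X : topologicalType) (c : X -> X -> bool) : Prop := {
  orient_irr : forall x, c x x = false;
  orient_asym : forall x y, x <> y -> c y x = ~~ c x y;
  orient_open : forall x y, c x y -> \forall u \near x & v \near y, c u v }.

Definition rel_of (X : Type) (c : X -> X -> bool) : set (X * X) :=
  [set p | p.1 = p.2 \/ c p.1 p.2].

Definition cyclic (X : Type) (c : X -> X -> bool) : Prop :=
  forall x y, c x y -> exists2 z, c y z & c z x.

(** An outside vertex has the same direction towards all the vertices of a
module; these sets are also called intervals or autonomous sets. *)
Definition module (X : Type) (c : X -> X -> bool) (B : set X) : Prop :=
  forall x y z, B x -> B y -> ~ B z -> c x z = c y z.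

Definition simple (X : Type) (c : X -> X -> bool) : Prop :=
  forall B, module c B -> forall x y, B x -> B y -> x <> y -> B = setT.

Section Orientation.
Variables (X : topologicalType) (c : X -> X -> bool).
Hypothesis oc : orientation c.

Lemma arc_neq x y : c x y -> x <> y.
Proof. by move=> + xy; rewrite xy orient_irr. Qed.

Lemma strict_rel_of x y : strict (rel_of c) (x, y) <-> c x y.
Proof.
split; first by case=> -[].
by move=> cxy; split; [right | exact: arc_neq].
Qed.

(** If x -> y, neighbourhoods U of x and V of y with U -> V cannot meet, because
no vertex is joined to itself. *)
Lemma orientation_hausdorff : hausdorff_space X.
Proof.
move=> x y clxy; apply: contrapT => nxy.
wlog cxy : x y nxy clxy / c x y.
  move=> wl; case cxy: (c x y); first exact: wl cxy.
  apply: (wl y x); first exact: nesym.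
    by move=> A B Ay Bx; rewrite setIC; exact: clxy.
  by rewrite (orient_asym oc nxy) cxy.
have [[U V] /= [Ux Vy] UV] := orient_open oc cxy.
have [z [Uz Vz]] := clxy _ _ Ux Vy.
by have := UV (z, z) (conj Uz Vz); rewrite /= orient_irr.
Qed.

Lemma compact_tournament_rel_of (x0 : X) :
  compact [set: X] -> compact_tournament (rel_of c).
Proof.
move=> cX; split => //; first exact: orientation_hausdorff.
  split; first by exists x0.
    apply/seteqP; split => -[x y] /=.
      rewrite /rel_of /=; case=> -[//|cxy] [|/= cyx]; first by move=> ->.
      by move: cyx; rewrite (orient_asym oc (arc_neq cxy)) cxy.
    by move=> xy; split; left.
  apply/seteqP; split => // -[x y] _.
  have [->|nxy] := pselect (x = y); first by left; left.
  case cxy: (c x y); first by left; right.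
  by right; right; rewrite /= (orient_asym oc nxy) cxy.
rewrite -[rel_of c]setCK; apply: open_closedC; rewrite openE => -[x y] nR.
have nxy : x <> y by move=> xy; apply: nR; left.
have cyx : c y x.
  by rewrite (orient_asym oc nxy); apply/negP => cxy; apply: nR; right.
have [[V U] /= [Vy Ux] UV] := orient_open oc cyx.
exists (U, V) => // -[u v] /= [Uu Vv]; have cvu : c v u := UV (v, u) (conj Vv Uu).
case=> /= [uv|]; first by move: cvu; rewrite uv orient_irr.
by rewrite (orient_asym oc (arc_neq cvu)) cvu.
Qed.

Lemma three_cycle_rel_of x y z :
  c x y -> c y z -> c z x -> three_cycle (rel_of c) [set x; y; z].
Proof.
by move=> cxy cyz czx; exists x, y, z; split => //; split; apply/strict_rel_of.
Qed.

Lemma arc_cyclic_rel_of : cyclic c -> arc_cyclic (rel_of c).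
Proof.
move=> cyc x y /strict_rel_of cxy; have [z cyz czx] := cyc _ _ cxy.
exists [set x; y; z]; first exact: three_cycle_rel_of.
by move=> u; left.
Qed.

(** The fibres of a quotient map are modules: a vertex that separated two vertices
of a fibre would be mapped to both sides of its image, hence into the fibre.  A
map that is not injective has a fibre with two vertices, so in a simple
tournament that fibre is everything and the quotient is a point. *)
Lemma prime_rel_of (x y : X) : compact [set: X] -> simple c -> x <> y ->
  prime_tournament (rel_of c).
Proof.
move=> cX sc nxy; have ct := compact_tournament_rel_of x cX.
split => //; first by exists x, y.
move=> Y S h [_ _ [_ SS ST] _] [y1 [y2 ny]] qh; split => // u v huv.
apply: contrapT => nuv; have [_ hsurj hR] := qh.
have hS a b : c a b -> S (h a, h b).
  by move=> cab; apply: hR; exists (a, b) => //; right.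
have hanti a b : c a b -> S (h b, h a) -> h a = h b.
  move=> /hS Sab Sba.
  by have : (S `&` (S^-1)%relation) (h a, h b) by []; rewrite SS.
pose B := [set w | h w = h u].
have BT : B = setT.
  apply: (sc B) nuv; rewrite /B //=.
  move=> p q w /= hp hq nBw.
  have npw : p <> w by move=> pw; apply: nBw; rewrite -pw.
  have nqw : q <> w by move=> qw; apply: nBw; rewrite -qw.
  case cpw: (c p w); case cqw: (c q w) => //; exfalso; apply: nBw.
    have /hS : c w q by rewrite (orient_asym oc nqw) cqw.
    by rewrite hq -hp => /(hanti _ _ cpw).
  have /hS : c w p by rewrite (orient_asym oc npw) cpw.
  by rewrite hp -hq => /(hanti _ _ cqw).
have hc w : h w = h u by have : B w by rewrite BT.
apply: ny.
have [w1 _ <-] : range h y1 by rewrite hsurj.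
have [w2 _ <-] : range h y2 by rewrite hsurj.
by rewrite !hc.
Qed.

(** A 3-cycle is given as a set of vertices; an arc between two of them fixes the
direction in which it is travelled. *)
Lemma three_cycle_inv x y z : c x y ->
  three_cycle (rel_of c) [set x; y; z] -> c y z /\ c z x.
Proof.
move=> cxy [a [b [d [E [/strict_rel_of cab /strict_rel_of cbd /strict_rel_of cda]]]]].
have nyx : c y x = false by rewrite (orient_asym oc (arc_neq cxy)) cxy.
have ex : [set a; b; d] x by rewrite -E; left; left.
have ey : [set a; b; d] y by rewrite -E; left; right.
have ea : [set x; y; z] a by rewrite E; left; left.
have eb : [set x; y; z] b by rewrite E; left; right.
have ed : [set x; y; z] d by rewrite E; right.
have ii := orient_irr oc.
case: ex => [[]|] /= ?; case: ey => [[]|] /= ?; subst; rewrite ?ii // in cxy nyx *;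
  rewrite ?cab ?cbd ?cda // in nyx.
- by case: ed => [[]|] /= ?; subst; rewrite ?ii // in cbd cda.
- by case: ea => [[]|] /= ?; subst; rewrite ?ii // in cab cda.
- by case: eb => [[]|] /= ?; subst; rewrite ?ii // in cab cbd.
Qed.

End Orientation.

(** * Signs and twisted products *)

(** The last field is what lets an arc that leaves a fibre be closed up: [x] has
partners of the opposite sign both among its successors and its predecessors. *)
Record signed (X : topologicalType) (c : X -> X -> bool) (s : X -> bool) :
    Prop := {
  signed_orient : orientation c;
  signed_loc : forall x, \forall u \near x, s u = s x;
  signed_nbr : forall x b, exists2 y, s y = ~~ s x & c x y = b }.

Definition sign_constant (X : Type) (s : X -> bool) (B : set X) : Prop :=
  forall x y, B x -> B y -> s x = s y.

(** Modules that contain both signs are not excluded here: once the tournament is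
a fibre of a larger one, the other fibres separate them. *)
Definition sign_simple (X : Type) (c : X -> X -> bool) (s : X -> bool) : Prop :=
  forall B, module c B -> sign_constant s B ->
    forall x y, B x -> B y -> x = y.

Definition sign_cyclic (X : Type) (c : X -> X -> bool) (s : X -> bool) : Prop :=
  forall x y, s x = s y -> c x y -> exists2 z, c y z & c z x.

Section Product.
Variables (J : choiceType) (p : J -> J -> bool) (twist : bool).
Hypothesis p_asym : forall i j, i <> j -> p j i = ~~ p i j.
Variables (E : topologicalType) (c : E -> E -> bool) (s : E -> bool).
Hypothesis sE : signed c s.

Local Notation D := (discrete_topology J).

(** The lexicographic product over [p]; when [twist] is set, an arc between two
fibres is reversed each time the sign of one of its ends changes. *)
Definition prod_arc (u v : D * E) : bool :=
  if u.1 == v.1 then c u.2 v.2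
  else p u.1 v.1 (+) (twist && (s u.2 (+) s v.2)).

Lemma prod_arc_fiber i x y : prod_arc (i, x) (i, y) = c x y.
Proof. by rewrite /prod_arc eqxx. Qed.

Lemma prod_arc_cross i j x y : i <> j ->
  prod_arc (i, x) (j, y) = p i j (+) (twist && (s x (+) s y)).
Proof. by move=> /eqP/negPf ij; rewrite /prod_arc ij. Qed.

Lemma nbhs_slice i x (U : set E) :
  nbhs x U -> nbhs ((i, x) : D * E) [set u | u.1 = i /\ U u.2].
Proof.
move=> Ux; exists ([set i], U); last by case=> a b [].
by split => //; exact: (@discrete_set1 D).
Qed.

Lemma prod_arc_orientation : orientation prod_arc.
Proof.
split.
- by move=> [i x]; rewrite prod_arc_fiber (orient_irr (signed_orient sE)).
- move=> [i x] [j y] nuv; have [ij|ij] := pselect (i = j).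
    subst j; rewrite !prod_arc_fiber (orient_asym (signed_orient sE)) //.
    by move=> xy; apply: nuv; rewrite xy.
  rewrite (prod_arc_cross _ _ ij) (prod_arc_cross _ _ (nesym ij)) p_asym //.
  by rewrite addNb [s y (+) _]addbC.
- move=> [i x] [j y] h; have [ij|ij] := pselect (i = j).
    subst j; rewrite prod_arc_fiber in h.
    have [[U V] /= [Ux Vy] UV] := orient_open (signed_orient sE) h.
    exists ([set u | u.1 = i /\ U u.2], [set u | u.1 = i /\ V u.2]).
      by split; exact: nbhs_slice.
    move=> [[i1 x1] [j1 y1]] /= [[-> Ux1] [-> Vy1]]; rewrite prod_arc_fiber.
    exact: (UV (x1, y1)).
  exists ([set u | u.1 = i /\ s u.2 = s x], [set u | u.1 = j /\ s u.2 = s y]).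
    split; first exact: nbhs_slice (signed_loc sE x).
    exact: nbhs_slice (signed_loc sE y).
  move=> [[i1 x1] [j1 y1]] /= [[-> sx] [-> sy]].
  by rewrite (prod_arc_cross _ _ ij) sx sy -(prod_arc_cross _ _ ij).
Qed.

Definition prod_sign (u : D * E) : bool := s u.2.

Lemma prod_signed : signed prod_arc prod_sign.
Proof.
split; first exact: prod_arc_orientation.
  move=> [i x]; apply: filterS (nbhs_slice i (signed_loc sE x)) => u [_].
  exact.
move=> [i x] b; have [y sy cy] := signed_nbr sE x b.
by exists (i, y) => //; rewrite prod_arc_fiber.
Qed.

Lemma module_slice (B : set (D * E)) i : module prod_arc B ->
  module c [set x | B (i, x)].
Proof.
by move=> mB x y z /= Bx By nBz; have := mB _ _ _ Bx By nBz; rewrite !prod_arc_fiber.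
Qed.

(** For x -> y in different fibres take a partner z of x, of opposite sign, with
z -> x: changing the sign of x reverses its arc with y, so y -> z. *)
Lemma prod_cyclic : twist -> cyclic c -> cyclic prod_arc.
Proof.
move=> tw cyc [i x] [j y]; have [ij|ij] := pselect (i = j).
  subst j; rewrite prod_arc_fiber => /cyc [z cyz czx].
  by exists (i, z); rewrite prod_arc_fiber.
move=> cxy; have [z sz cxz] := signed_nbr sE x false.
exists (i, z).
  rewrite (orient_asym prod_arc_orientation (x := (i, z))); last first.
    by case=> /esym /nesym.
  by move: cxy; rewrite !prod_arc_cross // tw sz /= addNb addbN => ->.
rewrite prod_arc_fiber (orient_asym (signed_orient sE) (x := x)) ?cxz //.
by move=> xz; move: sz; rewrite xz; case: (s z).
Qed.

(** A module that meets two fibres contains a partner of one of its vertices [x]: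
the direction of the partner towards [x] can be chosen against its direction
towards the vertex in the other fibre.  So it has two vertices in one fibre,
contains that fibre by simplicity, and then every vertex of the other fibres,
which all see both directions in it. *)
Lemma prod_simple : twist -> simple c -> simple prod_arc.
Proof.
move=> tw sc B mB.
have splitF i j x y z : i <> j -> s y = ~~ s x ->
    prod_arc (i, y) (j, z) = ~~ prod_arc (i, x) (j, z).
  by move=> ij sy; rewrite !prod_arc_cross // tw sy /= addNb addbN.
have spread i x y : B (i, x) -> B (i, y) -> s y = ~~ s x ->
    forall j z, j <> i -> B (j, z).
  move=> Bx By sxy j z ji; apply: contrapT => nBz.
  have := mB _ _ _ Bx By nBz; rewrite (splitF i j x y) //; last exact: nesym.
  by case: (prod_arc _ _).
have full i x y : B (i, x) -> B (i, y) -> x <> y -> B = setT.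
  move=> Bx By nxy.
  have Bi z : B (i, z).
    have : [set x | B (i, x)] = setT by exact: (sc _ (module_slice (i:=i) mB) _ _ Bx By).
    by move=> /seteqP[_ /(_ z I)].
  apply/seteqP; split => // -[j z] _.
  have [->|ji] := pselect (j = i); first exact: Bi.
  have [w sw _] := signed_nbr sE x true.
  exact: (spread _ _ _ (Bi x) (Bi w) sw).
move=> [i x] [j y] Bx By nxy; have [ij|ij] := pselect (i = j).
  by subst j; apply: (full i x y) => // xy; apply: nxy; rewrite xy.
have [z sz cxz] := signed_nbr sE x (prod_arc (j, y) (i, x)).
have Bz : B (i, z).
  apply: contrapT => nBz; have := mB _ _ _ Bx By nBz.
  have ji := nesym ij.
  rewrite prod_arc_fiber cxz !prod_arc_cross // tw sz /= addbN addbN.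
  by case: (_ (+) _).
by apply: (full i x z) => // xz; move: sz; rewrite xz; case: (s z).
Qed.


(** The same choice of a partner produces a vertex of the opposite sign, so a
module of constant sign stays in one fibre. *)
Lemma prod_sign_simple : sign_simple c s -> sign_simple prod_arc prod_sign.
Proof.
move=> ssc B mB sB [i x] [j y] Bx By; have [ij|ij] := pselect (i = j).
  subst j; congr (_, _); apply: (ssc _ (module_slice (i:=i) mB)) => //.
  by move=> x1 y1 Bx1 By1; exact: (sB (i, x1) (i, y1)).
have [z sz cxz] := signed_nbr sE x (~~ (p j i (+) (twist && (s y (+) ~~ s x)))).
have Bz : B (i, z).
  apply: contrapT => nBz; have := mB _ _ _ Bx By nBz.
  rewrite prod_arc_fiber cxz prod_arc_cross ?sz; last exact: nesym.
  by case: (_ (+) _).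
by have := sB _ _ Bx Bz; rewrite /prod_sign /= sz; case: (s x).
Qed.

End Product.

(** * Towers *)

(** Countably many copies of [E], the levels, converging to one new point. *)
Definition tower (E : topologicalType) : topologicalType :=
  one_point_compactification (nat * E)%type.

Section TowerTopology.
Variable E : topologicalType.
Hypothesis cE : compact [set: E].

Lemma nbhs_tower_top (U : set (tower E)) :
  nbhs (None : tower E) U <->
  U None /\ exists N, forall n x, N <= n -> U (Some (n, x)).
Proof.
split=> [[W [cW _] WU]|[U0 [N NU]]].
  split; first by apply: WU; right.
  move/compact_near_coveringP : cW => /(_ _ \oo (fun n p => p.1 < n)).
  case=> [[k x] _ /=|N _ NW].
    exists ([set p | p.1 = k], [set n | k < n]).
      split; last exact: nbhs_infty_gt.
      exists ([set k], setT); last by case=> a b [].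
      by split; [exact: discrete_set1 | exact: filterT].
    by move=> [[a b] n] /= [->].
  exists N => n x Nn; apply: WU; left; exists (n, x) => //= Wn.
  by have := NW n Nn _ Wn; rewrite /= ltnn.
exists ([set k | k < N] `*` setT).
  split; first exact: compact_setX (finite_compact (finite_II N)) cE.
  rewrite -[X in closed X]/(_ `*` _) setXT.
  apply: (@closed_comp _ _ fst); last exact: discrete_closed.
  by move=> x _; exact: cvg_fst.
move=> z [[[n x] nN <-]|->] //; apply: NU.
by rewrite leqNgt; apply/negP => ?; apply: nN.
Qed.

Lemma nbhs_tower_level n x (U : set (tower E)) :
  nbhs (Some (n, x) : tower E) U <-> nbhs x [set y | U (Some (n, y))].
Proof.
split=> [[[V W] /= [Vn Wx] VWU]|Ux].
  by apply: filterS Wx => y Wy; apply: VWU; split => //; exact: nbhs_singleton.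
exists ([set n], [set y | U (Some (n, y))]); last by case=> a b /= [-> ].
by split => //; exact: discrete_set1.
Qed.

End TowerTopology.

Section TowerArc.
Variables (E : topologicalType) (c : E -> E -> bool) (s : E -> bool).
Hypothesis cE : compact [set: E].
Hypothesis sE : signed c s.

(** The direction of [u] towards a point [v] of a higher level (or the top) depends
on the sign of [u] alone, which makes it continuous at the top.  Consecutive
levels also take the sign of [v] into account: this is how a level separates
points of the level above it, and for positive points it gives the arcs
[i + 1 -> i] of [L1]. *)
Definition tower_up (u v : tower E) : bool :=
  match u, v with
  | Some (n, x), Some (m, y) => if m == n.+1 then s x (+) s y else s x
  | Some (n, x), None => s x
  | None, _ => true
  end.

Definition below (u v : tower E) : bool :=
  match u, v with
  | Some (n, _), Some (m, _) => n < m
  | Some _, None => true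
  | None, _ => false
  end.

Definition tower_arc (u v : tower E) : bool :=
  match u, v with
  | Some (n, x), Some (m, y) =>
    if n == m then c x y else if n < m then tower_up u v else ~~ tower_up v u
  | Some _, None => tower_up u v
  | None, Some _ => ~~ tower_up v u
  | None, None => false
  end.

(** The sign of a tower is not that of its levels: it is constant near the top, so
that products over a base see the top points as the base does, and negative on
level 0, which has arcs in both directions with every later point. *)
Definition tower_sign (u : tower E) : bool :=
  if u is Some (n, _) then 0 < n else true.

Arguments tower_arc : simpl never.

Lemma tower_arc_fiber n x y : tower_arc (Some (n, x)) (Some (n, y)) = c x y.
Proof. by rewrite /tower_arc eqxx. Qed.

Lemma tower_arc_below u v : below u v -> tower_arc u v = tower_up u v.
Proof.
case: u v => [[n x]|] [[m y]|] //=; rewrite /tower_arc => nm.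
by rewrite (ltn_eqF nm) nm.
Qed.

Lemma tower_arc_above u v : below u v -> tower_arc v u = ~~ tower_up u v.
Proof.
case: u v => [[n x]|] [[m y]|] //=; rewrite /tower_arc => nm.
by rewrite (gtn_eqF nm) ltnNge (ltnW nm).
Qed.

Lemma belowP u v : u <> v ->
  [\/ exists n x y, [/\ u = Some (n, x), v = Some (n, y) & x <> y],
      below u v | below v u].
Proof.
case: u v => [[n x]|] [[m y]|] uv //; try by [apply: Or32 | apply: Or33].
case: (ltngtP n m) => nm; [exact: Or32|exact: Or33|apply: Or31]; subst m.
by exists n, x, y; split => // xy; apply: uv; rewrite xy.
Qed.

Lemma tower_up_flip n x x' v : below (Some (n, x)) v -> s x' = ~~ s x ->
  tower_up (Some (n, x')) v = ~~ tower_up (Some (n, x)) v.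
Proof. by case: v => [[m y]|] //= _ ->; case: ifP => //; rewrite addNb. Qed.

Lemma tower_orientation : orientation tower_arc.
Proof.
have oc := signed_orient sE.
have lvl n x U : nbhs x U ->
    nbhs (Some (n, x) : tower E) [set u | exists2 y, u = Some (n, y) & U y].
  by move=> Ux; apply/nbhs_tower_level; apply: filterS Ux => y Uy; exists y.
have top n : nbhs (None : tower E) [set v | forall x, below (Some (n.+1, x)) v].
  by apply/(nbhs_tower_top cE); split => //; exists n.+2 => m x nm y.
have up_open u v : below u v ->
    \forall u' \near u & v' \near v, below u' v' /\ tower_up u' v' = tower_up u v.
  case: u v => [[n x]|] [[m y]|] //= nm.
    exists ([set u | exists2 x', u = Some (n, x') & s x' = s x],
            [set u | exists2 y', u = Some (m, y') & s y' = s y]).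
      by split; apply: lvl; exact: (signed_loc sE).
    by move=> [_ _] [[x' -> /= sx'] [y' -> /= sy']]; rewrite sx' sy'.
  exists ([set u | exists2 x', u = Some (n, x') & s x' = s x],
          [set v | forall x, below (Some (n.+1, x)) v]).
    by split; [apply: lvl; exact: (signed_loc sE) | exact: top].
  move=> [_ v] [[x' -> /= sx'] /(_ x')].
  by case: v => [[m y]|] //= k; rewrite sx' (gtn_eqF k); split => //; exact: ltnW.
split.
- by case=> [[n x]|] //; rewrite tower_arc_fiber (orient_irr oc).
- move=> u v /belowP[[n [x [y [-> -> xy]]]]|uv|vu].
  + by rewrite !tower_arc_fiber (orient_asym oc).
  + by rewrite (tower_arc_below uv) (tower_arc_above uv).
  + by rewrite (tower_arc_below vu) (tower_arc_above vu) negbK.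
- move=> u v cuv; have uv : u <> v.
    move=> uv; move: cuv; rewrite uv; case: v {uv u} => [[n x]|] //.
    by rewrite tower_arc_fiber (orient_irr oc).
  have [[n [x [y [? ? xy]]]]|uv'|vu] := belowP uv.
  + subst u v; rewrite tower_arc_fiber in cuv.
    have [[U V] /= [Ux Vy] UV] := orient_open oc cuv.
    exists ([set u | exists2 x', u = Some (n, x') & U x'],
            [set u | exists2 y', u = Some (n, y') & V y']).
      by split; exact: lvl.
    move=> [_ _] [[x' -> /= sx'] [y' -> /= sy']] /=; rewrite tower_arc_fiber.
    exact: (UV (x', y')).
  + have [[U V] /= [Ux Vy] UV] := up_open _ _ uv'.
    exists (U, V) => // -[a b] UVab; have [/= ab e] := UV _ UVab.
    by rewrite /= tower_arc_below // e -tower_arc_below.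
  + have [[U V] /= [Ux Vy] UV] := up_open _ _ vu.
    exists (V, U) => // -[a b] [Va Ub]; have [/= ab e] := UV (b, a) (conj Ub Va).
    by rewrite /= tower_arc_above // e -tower_arc_above.
Qed.

Lemma tower_loc u : \forall v \near u, tower_sign v = tower_sign u.
Proof.
case: u => [[n x]|].
  by apply/nbhs_tower_level; apply: filterS (filterT (F := nbhs x)).
by apply/(nbhs_tower_top cE); split => //; exists 1 => -[|n] x.
Qed.

Variable x0 : E.

Lemma tower_signed : signed tower_arc tower_sign.
Proof.
have pick b : exists x, s x = b.
  case sb: (s x0 == b); first by exists x0; apply/eqP.
  have [y sy _] := signed_nbr sE x0 b.
  by exists y; rewrite sy; case: (s x0) b sb => -[].
split; [exact: tower_orientation | exact: tower_loc |].
(* A point of level 0 finds its partners on level 1 or 2, any later point on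
   level 0. *)
case=> [[[|n] x]|] b.
- case sxb : (s x == b).
    have [y sy] := pick true.
    by exists (Some (2, y)) => //; rewrite tower_arc_below //=; apply/eqP.
  have [y sy] := pick true.
  exists (Some (1, y)) => //; rewrite tower_arc_below //= sy.
  by move: sxb; case: (s x); case: (b).
- case: n => [|n].
    have [y sy] := pick (s x (+) ~~ b).
    exists (Some (0, y)) => //; rewrite tower_arc_above //= sy.
    by case: (s x); case: (b).
  have [y sy] := pick (~~ b).
  by exists (Some (0, y)) => //; rewrite tower_arc_above //= sy negbK.
- have [y sy] := pick (~~ b).
  by exists (Some (0, y)) => //; rewrite tower_arc_above //= sy negbK.
Qed.

Lemma sign_neq x y : s y = ~~ s x -> x <> y.
Proof. by move=> + xy; rewrite xy; case: (s y). Qed.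

(** Within a level, arcs between vertices of the same sign are closed in [E], and
arcs between vertices of opposite sign by a vertex of the next level, which
separates them.  An arc that joins two levels is closed by a partner of its
lower end. *)
Lemma tower_cyclic : sign_cyclic c s -> cyclic tower_arc.
Proof.
move=> cyc u v cuv; have oc := signed_orient sE; have ot := tower_orientation.
have cross n x w : below (Some (n, x)) w ->
    exists2 z, tower_arc (Some (n, x)) z = ~~ tower_arc (Some (n, x)) w
             & tower_arc w z = tower_arc (Some (n, x)) w.
  move=> xw; have [y sy cy] := signed_nbr sE x (~~ tower_up (Some (n, x)) w).
  exists (Some (n, y)); first by rewrite tower_arc_fiber tower_arc_below.
  by rewrite tower_arc_above // (tower_up_flip xw sy) negbK tower_arc_below.
have [[n [x [y [? ? xy]]]]|uv|vu] := belowP (arc_neq ot cuv).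
- subst u v; rewrite tower_arc_fiber in cuv.
  have [sxy|sxy] := eqVneq (s x) (s y).
    have [z cyz czx] := cyc _ _ sxy cuv.
    by exists (Some (n, z)); rewrite tower_arc_fiber.
  exists (Some (n.+1, x)).
    by rewrite tower_arc_below //= eqxx; case: (s x) (s y) sxy => -[].
  by rewrite tower_arc_above //= eqxx addbb.
- case: u uv cuv => [[n x]|] // uv cuv; have [z cxz czv] := cross _ _ _ uv.
  rewrite cuv in cxz czv; exists z => //.
  rewrite (orient_asym ot (x := Some (n, x))) ?cxz // => xz.
  move: cuv; rewrite (orient_asym ot (x := v)) ?xz ?czv // => vz.
  by move: czv; rewrite vz (orient_irr ot).
- case: v vu cuv => [[n x]|] // vu cuv; have [z cxz czu] := cross _ _ _ vu.
  have cxu : tower_arc (Some (n, x)) u = false.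
    by rewrite (orient_asym ot (x := u)) ?cuv //; exact: (arc_neq ot cuv).
  rewrite cxu in cxz czu; exists z => //.
  rewrite (orient_asym ot (x := u)) ?czu // => uz.
  by move: cxz; rewrite -uz cxu.
Qed.

(** A module with two vertices contains two vertices of one level with opposite
signs: if it meets two levels, it contains a partner of a vertex of the lower one,
and inside a level [sign_simple] forbids a constant sign.  Those two vertices
are separated by all the later levels and by the top; lower levels then follow one
by one, since consecutive levels are twisted. *)
Lemma tower_simple : sign_simple c s -> simple tower_arc.
Proof.
move=> ssc B mB; have oc := signed_orient sE; have ot := tower_orientation.
have split2 n x y v : B (Some (n, x)) -> B (Some (n, y)) -> s y = ~~ s x ->
    below (Some (n, x)) v -> B v.
  move=> Bx By sxy xv; apply: contrapT => nBv; have := mB _ _ _ Bx By nBv.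
  by rewrite !tower_arc_below // (tower_up_flip xv sxy); case: (tower_up _ _).
have opp (x : E) : exists y, s y = ~~ s x.
  by have [y sy _] := signed_nbr sE x true; exists y.
have down n : (forall x, B (Some (n.+1, x))) -> forall x, B (Some (n, x)).
  move=> Bn x; apply: contrapT => nBx; have [y sy] := opp x.
  have := mB _ _ _ (Bn x) (Bn y) nBx.
  by rewrite !tower_arc_above //= eqxx sy addbN; case: (_ (+) _).
have full n x y : B (Some (n, x)) -> B (Some (n, y)) -> s y = ~~ s x -> B = setT.
  move=> Bx By sxy; apply/seteqP; split => // -[[m z]|] _; last first.
    exact: split2 Bx By sxy _.
  (* [d] counts how far below level [n.+1] one has already come. *)
  suff lvl d : forall k, n < k + d -> forall w, B (Some (k, w)).
    by apply: (lvl n.+1); rewrite ltn_addl.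
  elim: d => [|d IH] k nk w.
    by rewrite addn0 in nk; exact: split2 Bx By sxy _.
  by apply: down => w'; apply: IH; rewrite addSnnS.
have same n x y : B (Some (n, x)) -> B (Some (n, y)) -> x <> y -> B = setT.
  move=> Bx By nxy; apply: contrapT => nB; apply: nxy.
  apply: (ssc [set z | B (Some (n, z))]) => //.
    by move=> u v z /= Bu Bv nBz; have := mB _ _ _ Bu Bv nBz; rewrite !tower_arc_fiber.
  move=> u v /= Bu Bv; apply/eqP/negPn/negP => suv; apply: nB.
  by apply: full Bu Bv _; case: (s u) (s v) suv => -[].
have cross n x v : B (Some (n, x)) -> B v -> below (Some (n, x)) v -> B = setT.
  move=> Bx Bv xv.
  have [y sy cxy] := signed_nbr sE x (~~ tower_up (Some (n, x)) v).
  apply: (same n x y) => //; last exact: sign_neq sy.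
  apply: contrapT => nBy; have := mB _ _ _ Bx Bv nBy.
  rewrite tower_arc_fiber cxy tower_arc_above // (tower_up_flip xv sy).
  by case: (tower_up _ _).
move=> u v Bu Bv /belowP[[n [x [y [? ? xy]]]]|uv|vu].
- by subst u v; exact: same Bu Bv xy.
- by case: u Bu uv => [[n x]|] // Bu uv; exact: cross Bu Bv uv.
- by case: v Bv vu => [[n x]|] // Bv vu; exact: cross Bv Bu vu.
Qed.

End TowerArc.

(** * The tournaments that serve as levels *)

(** The strong tournament on four vertices: a 4-cycle along which the first
coordinate, its sign, alternates, and two diagonals. *)
Definition quad_arc (x y : bool * bool) : bool :=
  if x.1 == y.1 then ~~ x.2 && y.2 else y.1 (+) x.2 (+) y.2.

Lemma nbhs_quad (x : bool * bool) : nbhs x [set x].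
Proof.
case: x => a b; exists ([set a], [set b]); first by split; exact: discrete_set1.
by move=> [u v] [/= -> ->].
Qed.

Lemma quad_signed : signed quad_arc fst.
Proof.
split.
- split; first by move=> [[] []].
    by move=> [[] []] [[] []] nxy //; case: nxy.
  move=> x y xy; exists ([set x], [set y]); first by split; exact: nbhs_quad.
  by move=> [a b] [/= -> ->].
- by move=> x; apply: filterS (nbhs_quad x) => _ ->.
- move=> [a b] d; exists (~~ a, ~~ a (+) b (+) d) => //.
  by case: a b d => [] [] [].
Qed.

Lemma quad_sign_cyclic : sign_cyclic quad_arc fst.
Proof.
move=> [a b] [_ b'] /= <-; rewrite /quad_arc /= eqxx => /andP[/negbTE-> ->].
by exists (~~ a, ~~ a); case: a.
Qed.

Lemma quad_sign_simple : sign_simple quad_arc fst.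
Proof.
move=> B mB sB [a b] [a' b'] Bx By; have /= aa' := sB _ _ Bx By; subst a'.
apply: contrapT => nxy; have nBz : ~ B (~~ a, true).
  by move=> /(sB _ _ Bx) /=; case: (a).
by have := mB _ _ _ Bx By nBz; case: a b b' nxy {Bx By nBz} => [] [] [].
Qed.

Definition diverge_at (x y : cantor_space) (n : nat) : Prop :=
  (forall i, i < n -> x i = y i) /\ x n <> y n.

(** Two sequences are compared at the first place where they differ, and the
outcome is twisted by their next letters.  Thus each cylinder is the twisted
product of its two halves, with the next letter as sign, at every depth. *)
Definition cantor_arc (x y : cantor_space) : bool :=
  `[< exists2 n, diverge_at x y n & y n (+) x n.+1 (+) y n.+1 >].

Lemma diverge_atC x y n : diverge_at x y n -> diverge_at y x n.
Proof. by move=> [e d]; split => [i /e//|/esym]. Qed.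

Lemma diverge_at_uniq x y n m : diverge_at x y n -> diverge_at x y m -> n = m.
Proof.
move=> [en dn] [em dm]; case: (ltngtP n m) => // nm.
  by case: dn; exact: em.
by case: dm; exact: en.
Qed.

Lemma diverge_at_ex x y : x <> y -> exists n, diverge_at x y n.
Proof.
move=> nxy; have ex : exists n, x n != y n.
  apply: contrapT => ne; apply: nxy; apply/funext => n; apply/eqP/negPn/negP => d.
  by apply: ne; exists n.
exists (ex_minn ex); case: ex_minnP => n /eqP d mn; split => // i ni.
by apply/eqP; apply: contraLR ni => /mn; rewrite -leqNgt.
Qed.

Lemma cantor_arcE x y n : diverge_at x y n ->
  cantor_arc x y = y n (+) x n.+1 (+) y n.+1.
Proof.
move=> d; apply/asboolP/idP => [[m dm]|]; last by exists n.
by rewrite (diverge_at_uniq d dm).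
Qed.

Lemma nbhs_prefix (x : cantor_space) n :
  nbhs x [set y : cantor_space | forall i, i < n -> y i = x i].
Proof.
elim: n => [|n IH]; first by apply: (@filterS _ (nbhs x) _ setT) => //; exact: filterT.
have xn : nbhs x [set y : cantor_space | y n = x n].
  have := @proj_continuous _ (fun=> bool) n x [set x n].
  by apply; exact: discrete_set1.
apply: filterS2 IH xn => y e en i; rewrite ltnS leq_eqVlt => /orP[/eqP->//|].
exact: e.
Qed.

Lemma cantor_orientation : orientation cantor_arc.
Proof.
split.
- by move=> x; apply/negP => /asboolP[n [_ []]].
- move=> x y /diverge_at_ex[n d]; rewrite (cantor_arcE d).
  rewrite (cantor_arcE (diverge_atC d)); case: d => _ /eqP.
  by case: (x n); case: (y n); case: (x n.+1); case: (y n.+1).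
- move=> x y cxy; have [n d _] := asboolP _ cxy.
  exists ([set u | forall i, i < n.+2 -> u i = x i],
          [set u | forall i, i < n.+2 -> u i = y i]).
    by split; exact: nbhs_prefix.
  move=> [u v] /= [ux vy].
  have duv : diverge_at u v n.
    split=> [i ni|]; last by rewrite ux // vy //; case: d.
    have ni2 : i < n.+2 by apply: ltn_trans ni _.
    by rewrite ux // vy //; case: d => e _; exact: e.
  by rewrite (cantor_arcE duv) !ux // !vy // -(cantor_arcE d).
Qed.

(** The letter after the flipped one is free and decides the direction of the arc
(Lemma [cantor_arc_flip]). *)
Definition flip_at (x : cantor_space) (n : nat) (b : bool) : cantor_space :=
  fun i => if i == n then ~~ x i else if i == n.+1 then b else x i.

Lemma diverge_at_flip x n b : diverge_at x (flip_at x n b) n.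
Proof.
split=> [i ni|]; rewrite /flip_at; last by rewrite eqxx; case: (x n).
by rewrite (ltn_eqF ni) ltn_eqF // ltnW.
Qed.

Lemma cantor_arc_flip x n b :
  cantor_arc x (flip_at x n b) = ~~ x n (+) x n.+1 (+) b.
Proof.
by rewrite (cantor_arcE (diverge_at_flip x n b)) /flip_at eqxx gtn_eqF ?eqxx.
Qed.

Definition cantor_sign (x : cantor_space) : bool := x 0.

Lemma cantor_signed : signed cantor_arc cantor_sign.
Proof.
split; first exact: cantor_orientation.
- by move=> x; apply: filterS (nbhs_prefix x 1) => y; apply.
- move=> x b; exists (flip_at x 0 (~~ x 0 (+) x 1 (+) b)) => //.
  by rewrite cantor_arc_flip addKb.
Qed.

(** The third vertex is a partner of [x] inside the cylinder of length [n.+1], so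
that the 3-cycle stays as close to [x] as [y] is. *)
Lemma cantor_cyclic_local x y n : diverge_at x y n -> cantor_arc x y ->
  exists z, [/\ forall i, i <= n -> z i = x i, cantor_arc y z & cantor_arc z x].
Proof.
move=> d cxy; pose b := ~~ x n.+1 (+) x n.+2.
have co := cantor_orientation.
exists (flip_at x n.+1 b); split.
- move=> i ni; have [e _] := diverge_at_flip x n.+1 b; by rewrite e.
- have dz : diverge_at y (flip_at x n.+1 b) n.
    have [e _] := diverge_at_flip x n.+1 b; case: d => exy nxy; split.
      by move=> i ni; rewrite -e ?exy // ltnW.
    by rewrite -e //; exact: nesym.
  move: cxy; rewrite (cantor_arcE d) (cantor_arcE dz) /flip_at eqxx.
  rewrite (ltn_eqF (ltnSn n)) (ltn_eqF (leqnSn n.+1)).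
  case: d => _ /eqP.
  by case: (x n); case: (y n); case: (x n.+1); case: (y n.+1).
- rewrite (orient_asym co (x := x)); last first.
    by move=> e; have [_] := diverge_at_flip x n.+1 b; rewrite -e.
  by rewrite cantor_arc_flip /b; case: (x n.+1); case: (x n.+2).
Qed.

Lemma cantor_cyclic : cyclic cantor_arc.
Proof.
move=> x y cxy; have [n d _] := asboolP _ cxy.
by have [z [_ cyz czx]] := cantor_cyclic_local d cxy; exists z.
Qed.

(** If two points of a module first differ at [n.+1], any point that leaves them
at [n] is separated by their letters at [n.+1], so it lies in the module as well.
Going down to [0], the module contains points of both signs. *)
Lemma cantor_sign_simple : sign_simple cantor_arc cantor_sign.
Proof.
move=> B mB sB x y Bx By; apply: contrapT => /diverge_at_ex[n].
elim: n => [|n IH] in y By *; first by case=> _; apply; exact: sB.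
move=> d; pose z := flip_at x n true.
have dz : diverge_at x z n := diverge_at_flip x n true.
apply: (IH z) => //; apply: contrapT => nBz.
have dyz : diverge_at y z n.
  case: d => e _; case: dz => ez nz; split=> [i ni|]; last by rewrite -e.
  by rewrite -e ?ez // ltnW.
have := mB _ _ _ Bx By nBz; rewrite (cantor_arcE dz) (cantor_arcE dyz).
by case: d => _; case: (x n.+1); case: (y n.+1); case: (z n); case: (z n.+1).
Qed.

Definition cantor1 : topologicalType := one_point_compactification cantor_space.

(** The Cantor tournament with one isolated point added; its out-set is read from
the second letter, which is independent of the sign. *)
Definition cantor1_arc (u v : cantor1) : bool :=
  match u, v with
  | Some x, Some y => cantor_arc x y
  | None, Some y => y 1
  | Some x, None => ~~ x 1
  | None, None => false
  end.

Definition cantor1_sign (u : cantor1) : bool :=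
  if u is Some x then cantor_sign x else true.

Lemma nbhs_cantor1_point : nbhs (None : cantor1) [set None].
Proof.
exists setT; first by split; [exact: cantor_space_compact | exact: closedT].
by move=> u [[x []]|].
Qed.

Lemma nbhs_cantor1_some (x : cantor_space) (U : set cantor_space) :
  nbhs x U -> nbhs (Some x : cantor1) [set u | exists2 y, u = Some y & U y].
Proof. by move=> Ux; apply: filterS Ux => y Uy; exists y. Qed.

Lemma cantor1_signed : signed cantor1_arc cantor1_sign.
Proof.
have co := cantor_orientation.
split.
- split.
  + by move=> [x|] //=; exact: orient_irr.
  + move=> [x|] [y|] //= nxy; last by rewrite negbK.
    by apply: (orient_asym co) => xy; apply: nxy; rewrite xy.
  + move=> [x|] [y|] //=.
    * move=> /(orient_open co)[[U V] /= [Ux Vy] UV].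
      exists ([set u | exists2 y, u = Some y & U y],
              [set u | exists2 y, u = Some y & V y]).
        by split; exact: nbhs_cantor1_some.
      by move=> [_ _] [[x' -> /= sx'] [y' -> /= sy']]; exact: (UV (x', y')).
    * move=> x1; pose V := [set y : cantor_space | forall i, i < 2 -> y i = x i].
      exists ([set u | exists2 y, u = Some y & V y], [set None]).
        split; last exact: nbhs_cantor1_point.
        exact: nbhs_cantor1_some (nbhs_prefix x 2).
      by move=> [_ _] [[x' -> /= sx'] -> /=]; rewrite sx'.
    * move=> y1; pose V := [set x : cantor_space | forall i, i < 2 -> x i = y i].
      exists ([set None], [set u | exists2 x, u = Some x & V x]).
        by split; [exact: nbhs_cantor1_point|exact: nbhs_cantor1_some (nbhs_prefix y 2)].
      by move=> [_ _] [-> [x' -> /= sx'] /=]; rewrite sx'.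
- move=> [x|]; last by apply: filterS nbhs_cantor1_point => _ ->.
  apply: filterS (nbhs_cantor1_some (signed_loc cantor_signed x)) => _ [y -> ].
  exact.
- move=> [x|] b.
    by have [y sy cy] := signed_nbr cantor_signed x b; exists (Some y).
  by exists (Some (fun i => (i == 1) && b)).
Qed.

Lemma cantor1_sign_cyclic : sign_cyclic cantor1_arc cantor1_sign.
Proof.
have co := cantor_orientation.
have back x n b : cantor_arc (flip_at x n b) x = ~~ cantor_arc x (flip_at x n b).
  apply: (orient_asym co) => e.
  by have [_] := diverge_at_flip x n b; rewrite -e.
move=> [x|] [y|] //= _.
- by move=> /cantor_cyclic[z cyz czx]; exists (Some z).
- move=> x1; exists (Some (flip_at x 1 (~~ x 1 (+) x 2))) => /=.
    by rewrite /flip_at /= x1.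
  by rewrite back cantor_arc_flip; case: (x 1); case: (x 2).
- move=> y1; exists (Some (flip_at y 1 (~~ y 1 (+) y 2 (+) true))) => /=.
    by rewrite cantor_arc_flip addKb.
  by rewrite /flip_at /= y1.
Qed.

Lemma cantor1_sign_simple : sign_simple cantor1_arc cantor1_sign.
Proof.
move=> B mB sB.
have small x y : B (Some x) -> B (Some y) -> x = y.
  apply: (cantor_sign_simple (B := [set x | B (Some x)])).
    by move=> u v z /= Bu Bv nBz; exact: (mB _ _ _ Bu Bv nBz).
  by move=> u v Bu Bv; exact: (sB _ _ Bu Bv).
have mixed x : B None -> B (Some x) -> False.
  move=> B0 Bx; pose z := flip_at x 1 (~~ x 2).
  have nBz : ~ B (Some z).
    move=> /(small x _ Bx) e; have [_] := diverge_at_flip x 1 (~~ x 2).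
    by rewrite -/z -e.
  have := mB _ _ _ B0 Bx nBz.
  by rewrite /= cantor_arc_flip /z /flip_at /=; case: (x 1); case: (x 2).
move=> [x|] [y|] Bx By //; last by case: (mixed y).
  by rewrite (small x y).
by case: (mixed x).
Qed.

(** * Cantor sets *)

(** A continuous bijection from a compact space to a Hausdorff space is closed. *)
Lemma compact_homeomorphic (K Y : topologicalType) (f : K -> Y) :
  compact [set: K] -> hausdorff_space Y -> continuous f -> injective f ->
  range f = setT -> homeomorphic Y K.
Proof.
move=> cK hY cf fi fs.
have ex y : exists x, f x = y.
  by have [x _ <-] : range f y by [rewrite fs]; exists x.
pose g y := projT1 (cid (ex y)).
have gK : cancel g f by move=> y; rewrite /g; case: cid.
have fK : cancel f g by move=> x; apply: fi; rewrite gK.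
exists g, f; split => //.
apply/continuous_closedP => A cA.
have -> : g @^-1` A = f @` A.
  apply/seteqP; split => [y Ay|_ [x Ax <-]]; first by exists (g y).
  by rewrite /= fK.
apply: compact_closed => //; apply: continuous_compact.
  exact: continuous_subspaceT.
exact: subclosed_compact cA cK _.
Qed.

Definition cantor_image (X : topologicalType) (A : set X) : Prop :=
  exists f : cantor_space -> X, [/\ continuous f, injective f & range f = A].

Lemma is_cantor_image (X : topologicalType) :
  hausdorff_space X -> cantor_image [set: X] -> is_cantor X.
Proof.
move=> hX [f [cf fi fs]].
exact: compact_homeomorphic cantor_space_compact hX cf fi fs.
Qed.

Lemma cantor_subset_image (X : topologicalType) (A : set X) :
  hausdorff_space X -> cantor_image A -> cantor_subset A.
Proof.
move=> hX [f [cf fi fA]].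
have Af y : f y \in A by rewrite inE -fA; exists y.
pose g y : A := exist _ (f y) (Af y).
have svg : set_val \o g = f by apply/funext => y; rewrite /= set_valE.
apply: is_cantor_image; last first.
  exists g; split.
  - apply: (@continuous_comp_initial A cantor_space X set_val g).
    by rewrite svg.
  - by move=> x y [/fi].
  - apply/seteqP; split => // -[a Aa] _.
    have [y _ ya] : range f a by rewrite fA; exact: set_mem.
    by exists y => //; exact: val_inj.
move=> a b ab; apply: val_inj; apply: hX => U V Ua Vb.
have cv := @initial_continuous A X set_val.
have [z []] := ab _ _ (cv a U Ua) (cv b V Vb).
by rewrite /= set_valE; exists (\val z).
Qed.

Lemma prefix_basis (x : cantor_space) (U : set cantor_space) :
  nbhs x U -> exists n, forall y, (forall i, i < n -> y i = x i) -> U y.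
Proof.
pose cyl n := [set y : cantor_space | forall i, i < n -> y i = x i].
pose F := filter_from [set: nat] cyl.
have FF : Filter F.
  apply: filter_from_filter; first by exists 0.
  move=> m n _ _; exists (maxn m n) => // y yx.
  by split=> i im; apply: yx; rewrite leq_max im ?orbT.
suff Fx : F --> x by move=> /Fx [n _ nU]; exists n => y yx; exact: nU.
apply/cvg_sup => i V [_ [[W oW <-] Wx WV]].
exists i.+1 => // y yx; apply: WV => /=; move: Wx => /=.
by rewrite /proj yx.
Qed.

Lemma cantor_continuous (X : topologicalType) (f : cantor_space -> X) :
  (forall x U, nbhs (f x) U ->
    exists n, forall y, (forall i, i < n -> y i = x i) -> U (f y)) ->
  continuous f.
Proof.
move=> h x U /h[n nU]; apply: filterS (nbhs_prefix x n) => y; exact: nU.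
Qed.

Definition shift (n : nat) (y : cantor_space) : cantor_space :=
  fun i => y (n + i).

(** A sequence with exactly [n] leading ones codes a point of level [n], given by
the letters after its first zero; the constant sequence codes the top. *)
Lemma cantor_image_tower (E : topologicalType) (A : set E) :
  compact [set: E] -> cantor_image A ->
  cantor_image [set u : tower E | forall n x, u = Some (n, x) -> A x].
Proof.
move=> cE [f [cf fi fA]].
pose lead (y : cantor_space) n := (forall i, i < n -> y i) /\ ~~ y n.
have leadP (y : cantor_space) : (exists n, lead y n) \/ forall n, y n.
  have [[n yn]|all] := pselect (exists n, ~~ y n); last first.
    by right => n; apply/negPn/negP => yn; apply: all; exists n.
  left; have ex : exists n, ~~ y n by exists n.
  exists (ex_minn ex); case: ex_minnP => k yk mk; split => // i ik.
  by apply: contraLR ik => /mk; rewrite -leqNgt.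
have lead_uniq y m n : lead y m -> lead y n -> m = n.
  move=> [am ym] [an yn]; case: (ltngtP m n) => // mn.
    by rewrite an in ym.
  by rewrite am in yn.
pose g (y : cantor_space) : tower E :=
  if pselect (exists n, lead y n) is left ex
  then Some (projT1 (cid ex), f (shift (projT1 (cid ex)).+1 y)) else None.
have gS y n : lead y n -> g y = Some (n, f (shift n.+1 y)).
  move=> yn; rewrite /g; case: pselect => [ex|ne]; last by case: ne; exists n.
  by case: cid => m ym /=; rewrite (lead_uniq _ _ _ ym yn).
have gN (y : cantor_space) : (forall n, y n) -> g y = None.
  by move=> yt; rewrite /g; case: pselect => // ex; have [n [_]] := ex; rewrite yt.
exists g; split.
- apply: cantor_continuous => y U; case: (leadP y) => [[n [yn nyn]]|yt].
    rewrite (gS y n) // => /nbhs_tower_level /= /cf/prefix_basis[k kU].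
    exists (n.+1 + k) => z zy.
    have zn : lead z n.
      split=> [i ni|]; last by rewrite zy // leq_addr.
      by rewrite zy ?yn // ltn_addr // ltnS ltnW.
    by rewrite (gS z n) //; apply: kU => i ik; apply: zy; rewrite ltn_add2l.
  rewrite gN // => /(nbhs_tower_top cE)[U0 [N NU]]; exists N => z zy.
  case: (leadP z) => [[n zn]|zt]; last by rewrite gN.
  rewrite (gS z n) //; apply: NU; rewrite leqNgt; apply/negP => nN.
  by case: zn => _; rewrite zy // yt.
- move=> y z; case: (leadP y) (leadP z) => [[n yn]|yt] [[m zm]|zt].
  + rewrite (gS y n) // (gS z m) // => -[nm /fi e]; subst m.
    apply/funext => i; case: (ltngtP i n) => [lin|lni|->].
    * by rewrite (proj1 yn) ?(proj1 zm).
    * by have := congr1 (fun h : cantor_space => h (i - n.+1)) e; rewrite /shift subnKC.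
    * by case: yn zm => _ /negbTE-> [_ /negbTE->].
  + by rewrite (gS y n) // gN.
  + by rewrite (gS z m) // gN.
  + by move=> _; apply/funext => i; rewrite yt zt.
- apply/seteqP; split=> [_ [y _ <-] n x|[[n x]|] uA].
    case: (leadP y) => [[m ym]|yt]; last by rewrite gN.
    by rewrite (gS y m) // => -[_ <-]; rewrite -fA; exists (shift m.+1 y).
  have [y _ yx] : range f x by rewrite fA; exact: uA.
  pose z : cantor_space := 
    fun i => if i < n then true else if i == n then false else y (i - n.+1).
  exists z => //.
  rewrite (gS z n).
    rewrite -yx; congr (Some (_, f _)); apply/funext => i.
    rewrite /shift /z addSn ltnNge ltnW ?ltnS ?leq_addr //=.
    by rewrite gtn_eqF ?ltnS ?leq_addr // subSS addKn.
  by split=> [i ni|]; rewrite /z ?ni // ltnn eqxx.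
by exists (fun=> true) => //; rewrite gN.
Qed.

(** A finite disjoint union of copies is coded by the prefix code 1, 01, 001, ...
(ending with zeros only) along an enumeration of the index set. *)
Lemma cantor_image_prod (J : finType) (j0 : J) (E : topologicalType)
    (A : set E) : cantor_image A ->
  cantor_image [set u : discrete_topology J * E | A u.2].
Proof.
move=> [f [cf fi fA]].
suff code (l : seq J) (j : J) : uniq (j :: l) ->
    cantor_image [set u : discrete_topology J * E | u.1 \in j :: l /\ A u.2].
  have := code (rem j0 (enum J)) j0.
  have e : perm_eq (enum J) (j0 :: rem j0 (enum J)).
    by apply: perm_to_rem; rewrite mem_enum.
  rewrite -(perm_uniq e) enum_uniq => /(_ isT); congr cantor_image.
  by apply/seteqP; split => [u []|u Au] //; split => //; rewrite -(perm_mem e) mem_enum.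
elim: l j => [|k l IH] j.
  move=> _; exists (fun y => (j : discrete_topology J, f y)); split.
  - apply: cantor_continuous => y U [[V W] /= [Vj Wy] VWU].
    have [n nW] := prefix_basis (cf y W Wy); exists n => z zy.
    by apply: VWU; split => /=; [exact: (nbhs_singleton Vj) | exact: nW].
  - by move=> y z [/fi].
  - apply/seteqP; split=> [_ [y _ <-] /=|[i x] [/=]].
      by rewrite inE eqxx -fA; split => //; exists y.
    by rewrite inE -fA => /eqP-> [y _ <-]; exists y.
move=> /andP[jl /IH[g [cg gi gl]]].
have gin y : (g y).1 \in k :: l /\ A (g y).2.
  have : range g (g y) by exists y.
  by rewrite gl.
pose h (y : cantor_space) : discrete_topology J * E :=
  if y 0 then (j : discrete_topology J, f (shift 1 y)) else g (shift 1 y).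
exists h; split.
- apply: cantor_continuous => y U; rewrite {1}/h; case: ifP => y0.
    move=> [[V W] /= [Vj Wy] VWU]; have [n nW] := prefix_basis (cf _ _ Wy).
    exists n.+1 => z zy; rewrite /h zy // y0; apply: VWU; split => /=.
      exact: (nbhs_singleton Vj).
    by apply: nW => i ni; apply: zy.
  move=> /cg/prefix_basis[n nU]; exists n.+1 => z zy; rewrite /h zy // y0.
  by apply: nU => i ni; apply: zy.
- have ext (y z : cantor_space) : y 0 = z 0 -> shift 1 y = shift 1 z -> y = z.
    move=> e0 e; apply/funext => -[|i] //.
    by have := congr1 (fun t : cantor_space => t i) e.
  move=> y z; rewrite /h; case: ifP => y0; case: ifP => z0.
  + by move=> [/fi]; apply: ext; rewrite y0 z0.
  + by move=> e; move: (proj1 (gin (shift 1 z))); rewrite -e (negbTE jl).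
  + by move=> e; move: (proj1 (gin (shift 1 y))); rewrite e (negbTE jl).
  + by move=> /gi; apply: ext; rewrite y0 z0.
- have h1 y : h (fun i => if i is i'.+1 then y i' else true)
      = (j : discrete_topology J, f y).
    by rewrite /h.
  have h0 y : h (fun i => if i is i'.+1 then y i' else false) = g y.
    by rewrite /h.
  apply/seteqP; split=> [_ [y _ <-]|[i x] [/=]].
    rewrite /h; case: ifP => _ /=.
      by rewrite inE eqxx -fA; split => //; exists (shift 1 y).
    by have [gkl Ag] := gin (shift 1 y); split => //; rewrite inE gkl orbT.
  rewrite inE => /orP[/eqP->|il Ax].
    by rewrite -fA => -[y _ <-]; rewrite -h1; eexists.
  have [y _ <-] : range g (i, x) by rewrite gl.
  by rewrite -h0; eexists.
Qed.

Lemma cantor_image_id : cantor_image [set: cantor_space].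
Proof.
exists id; split => //; first by move=> x.
by apply/seteqP; split => // x _; exists x.
Qed.

Lemma cantor_image_some : cantor_image (range (Some : cantor_space -> cantor1)).
Proof.
exists (Some : cantor_space -> cantor1); split => //.
exact: one_point_compactification_some_continuous.
Qed.

(** * Isolated points of products and towers *)

Lemma isolatedP (X : topologicalType) (x : X) :
  isolated_points x <-> nbhs x [set x].
Proof.
split=> [[_ [V Vx e]]|xx]; first by move: e; rewrite setIT => <-.
by split; [rewrite inE | exists [set x]; rewrite ?setIT].
Qed.

Section IsolatedProduct.
Variables (J : choiceType) (Y : topologicalType).
Local Notation D := (discrete_topology J).

Lemma nbhs_prod_discrete (i : D) (u : Y) (U : set (D * Y)) :
  nbhs (i, u) U <-> nbhs u [set v | U (i, v)].
Proof.
split=> [[[V W] /= [Vi Wu] VWU]|Uu].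
  apply: filterS Wu => v Wv; apply: VWU; split => //; exact: (nbhs_singleton Vi).
by apply: filterS (nbhs_slice i Uu) => -[j v] /= [->].
Qed.

Lemma isolated_prod (i : D) (u : Y) :
  @isolated_points (D * Y)%type (i, u) <-> isolated_points u.
Proof.
split=> /isolatedP iu; apply/isolatedP.
  by move/nbhs_prod_discrete: iu; apply: filterS => v [].
by apply/nbhs_prod_discrete; apply: filterS iu => v ->.
Qed.

Lemma limit_isolated_prod (i : D) (u : Y) :
  limit_point (@isolated_points (D * Y)%type) (i, u) <->
  limit_point (@isolated_points Y) u.
Proof.
split=> lu U Uu.
  have [|[j v] [jv /isolated_prod iv /= [ji Uv]]] := lu [set w | w.1 = i /\ U w.2].
    exact: nbhs_slice.
  by subst j; exists v; split => //; apply: contra_neq jv => ->.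
move/nbhs_prod_discrete : Uu => /lu[v [vu iv Uv]].
exists (i, v); split => //; last exact/isolated_prod.
by apply: contra_neq vu => -[].
Qed.

End IsolatedProduct.

Section IsolatedTower.
Variable E : topologicalType.
Hypothesis cE : compact [set: E].

Lemma isolated_tower_level n (x : E) :
  @isolated_points (tower E) (Some (n, x)) <-> isolated_points x.
Proof.
split=> /isolatedP ix; apply/isolatedP.
  by move/nbhs_tower_level: ix; apply: filterS => y [].
by apply/nbhs_tower_level; apply: filterS ix => y ->.
Qed.

Lemma limit_isolated_tower_level n (x : E) :
  limit_point (@isolated_points (tower E)) (Some (n, x)) <->
  limit_point (@isolated_points E) x.
Proof.
split=> lx U Ux.
  have [|[[m y]|] [yx iy Uy]] := lx [set u | exists2 y, u = Some (n, y) & U y].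
  - by apply/nbhs_tower_level; apply: filterS Ux => y Uy; exists y.
  - case: Uy iy yx => z [-> ->] Uz /isolated_tower_level iz zx; exists z; split => //.
    by apply: contra_neq zx => ->.
  - by case: Uy.
move/nbhs_tower_level : Ux => /lx[y [yx iy Uy]].
exists (Some (n, y)); split => //; last exact/isolated_tower_level.
by apply: contra_neq yx => -[].
Qed.

Lemma limit_isolated_tower_top (x : E) : isolated_points x ->
  limit_point (@isolated_points (tower E)) None.
Proof.
move=> ix U /(nbhs_tower_top cE)[U0 [N NU]].
by exists (Some (N, x)); split => //; [exact/isolated_tower_level | exact: NU].
Qed.

Lemma not_isolated_tower_top (x : E) : ~ @isolated_points (tower E) None.
Proof. by move=> /isolatedP /(nbhs_tower_top cE)[_ [N /(_ N x (leqnn N))]]. Qed.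

End IsolatedTower.

Lemma isolated_quad (x : bool * bool) : isolated_points x.
Proof. exact/isolatedP/nbhs_quad. Qed.

Lemma not_isolated_cantor (x : cantor_space) : ~ isolated_points x.
Proof.
move=> /isolatedP /prefix_basis[n nx].
have [e d] := diverge_at_flip x n true.
by apply: d; rewrite (nx (flip_at x n true)) // => i /e.
Qed.

Lemma isolated_cantor1 (u : cantor1) : isolated_points u <-> u = None.
Proof.
case: u => [x|]; split => //; last by move=> _; exact/isolatedP/nbhs_cantor1_point.
move=> /isolatedP xx; case: (@not_isolated_cantor x); apply/isolatedP.
have : nbhs x (Some @^-1` [set (Some x : cantor1)]) by [].
by apply: filterS => y [].
Qed.

Lemma limit_isolated_cantor1 (u : cantor1) :
  ~ limit_point (@isolated_points cantor1) u.
Proof.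
case: u => [x|] lu.
  have [|v [_ /isolated_cantor1 ->]] := lu [set v | v <> None].
    by apply: filterS (nbhs_cantor1_some (@filterT _ (nbhs x) _)) => _ [y -> _].
  exact.
have [v [/eqP]] := lu _ nbhs_cantor1_point.
by move=> nv _ /= vN; exact: nv.
Qed.

Lemma card_eq_nat (T : Type) (C : countType) (A : set T) (f : C -> T)
    (g : nat -> T) (h : T -> nat) :
  A `<=` range f -> (forall n, A (g n)) -> cancel g h -> A #= [set: nat].
Proof.
move=> Af Ag gK; apply: eq_card_nat.
  apply: sub_countable (subset_card_le Af) _.
  exact: sub_countable (card_image_le _ _) (countableP _).
move=> fA; apply: infinite_nat.
apply: sub_finite_set (finite_image h fA) => n _.
by exists (g n).
Qed.

(** * Towers over a finite tournament *)

Lemma compact_tower (E : topologicalType) : compact [set: tower E].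
Proof. exact: one_point_compactification_compact. Qed.

Lemma compact_prod_discrete (J : finType) (E : topologicalType) :
  compact [set: E] -> compact [set: (discrete_topology J * E)%type].
Proof.
move=> cE; rewrite -setXTT; apply: compact_setX cE.
by apply: finite_compact; exact: (@finite_finset J setT).
Qed.

Section Blowup.
Variables (J : finType).
Variable P : set (discrete_topology J * discrete_topology J).
Hypothesis hP : tournament P.
Variables (E : topologicalType) (c : E -> E -> bool) (s : E -> bool).
Hypotheses (cE : compact [set: E]) (sE : signed c s).
Variable x0 : E.

Definition base_arc (i j : J) : bool := `[< P (i, j) >].

Lemma base_arc_asym i j : i <> j -> base_arc j i = ~~ base_arc i j.
Proof.
move=> nij; have [_ PI PU] := hP; rewrite /base_arc.
case: (asboolP (P (j, i))) => Pji; case: (asboolP (P (i, j))) => Pij //.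
  by case: nij; have : (P `&` P^-1%relation) (i, j) by []; rewrite PI.
by have : (P `|` P^-1%relation) (i, j) by [rewrite PU]; case.
Qed.

(** One tower for each vertex of the base; the prescribed tournament is carried by
the tops. *)
Definition blowup : topologicalType := (discrete_topology J * tower E)%type.

Definition blowup_arc : blowup -> blowup -> bool :=
  prod_arc base_arc true (tower_arc c s) (@tower_sign E).

(** All tops have the same sign, so the twist does not show between them. *)
Lemma restr_blowup (F : set blowup) : (forall u, F u <-> u.2 = None) ->
  isomorphic (restr (rel_of blowup_arc) (A := F)) P.
Proof.
move=> hF; have [[j0 _] PI _] := hP.
have Fval (u : F) : (set_val u).2 = None.
  by case: u => u Fu; rewrite set_valE /=; apply/hF; exact: set_mem.
exists (fun u : F => (set_val u).1); split; last first.
  move=> u v uv; apply: val_inj; have := Fval u; have := Fval v.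
  rewrite !set_valE in uv *; move: uv.
  by case: (\val u) (\val v) => [i a] [j b] /= -> -> ->.
split.
- move=> u; apply: continuous_comp; last exact: cvg_fst.
  exact: (@initial_continuous F blowup set_val).
- apply/seteqP; split => // j _.
  have Fj : ((j, None) : blowup) \in F by rewrite inE; exact/hF.
  by exists (exist _ (j, None) Fj) => //=; rewrite set_valE.
- move=> _ [[u v] uv <-] /=; move: uv; rewrite /restr /rel_of /=.
  have := Fval u; have := Fval v; case: (set_val u) (set_val v) => [i a] [j b] /= -> ->.
  have Pii k : P (k, k) by have [] : (P `&` P^-1%relation) (k, k) by rewrite PI.
  case=> [[->] //|]; have [->//|nij] := pselect (i = j).
  by rewrite /blowup_arc prod_arc_cross // addbF => /asboolP.
Qed.

Lemma blowup_orientation : orientation blowup_arc.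
Proof. exact: (prod_arc_orientation _ base_arc_asym (tower_signed cE sE x0)). Qed.

Hypothesis sc : sign_simple c s.

Lemma blowup_prime : prime_tournament (rel_of blowup_arc).
Proof.
have [[j0 _] _ _] := hP.
apply: (@prime_rel_of _ _ blowup_orientation (j0, None) (j0, Some (0, x0))).
- exact: compact_prod_discrete (@compact_tower E).
- exact: (prod_simple (tower_signed cE sE x0) isT (tower_simple cE sE sc)).
- by [].
Qed.

Lemma blowup_arc_cyclic : sign_cyclic c s -> arc_cyclic (rel_of blowup_arc).
Proof.
move=> cyc; apply: (arc_cyclic_rel_of blowup_orientation).
exact: (prod_cyclic base_arc_asym (tower_signed cE sE x0) isT (tower_cyclic cE sE cyc)).
Qed.

Lemma finite_tower_tops (F : set blowup) :
  (forall u, F u <-> u.2 = None) -> finite_set F.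
Proof.
move=> hF; apply: (@sub_finite_set _ _ [set ((j, None) : blowup) | j in [set: J]]).
  by move=> [j u] /hF /= ->; exists j.
apply: finite_image; exact: (@finite_finset J setT).
Qed.

End Blowup.

Lemma tournament_point (J : Type) (P : set (J * J)) : tournament P -> exists j : J, True.
Proof. by case=> -[j _] _ _; exists j. Qed.

(** * The realizations *)

(** With finite levels, only the tops are limit points. *)
Lemma countable_realization (J : finType)
    (P : set (discrete_topology J * discrete_topology J)) (hP : tournament P) :
   exists (X : topologicalType) (R : set (X * X)),
     let F := ~` @isolated_points X in
     [/\ arc_cyclic R, prime_tournament R, [set: X] #= [set: nat],
         finite_set F & isomorphic (@restr X R F) P].
Proof.
have cQ : compact [set: (bool * bool)%type].
  by rewrite -setXTT; apply: compact_setX; exact: bool_compact.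
have hF (u : blowup J (bool * bool)%type) : (~` @isolated_points _) u <-> u.2 = None.
  case: u => i [[n x]|]; split => //=.
    case; apply/isolated_prod/isolated_tower_level; exact: isolated_quad.
  by move=> _ /isolated_prod /(not_isolated_tower_top cQ); apply; exact: (true, true).
exists (blowup J (bool * bool)%type), (rel_of (blowup_arc P quad_arc fst)) => F.
have x0 : bool * bool := (true, true).
split.
- exact: (blowup_arc_cyclic hP cQ quad_signed x0 quad_sign_cyclic).
- exact: (blowup_prime hP cQ quad_signed x0 quad_sign_simple).
- have [j0 _] := tournament_point hP.
  apply: (@card_eq_nat _ (J * option (nat * (bool * bool)))%type _ id
    (fun n => (j0, Some (n, x0))) (fun u => if u.2 is Some (n, _) then n else 0)) => //.
- exact (finite_tower_tops hF).
- exact (restr_blowup hP _ _ hF).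
Qed.

(** Each level has one isolated point, so isolated points accumulate exactly at the
tops; deleting them leaves finitely many towers of Cantor sets. *)
Lemma cantor_with_isolated_points_realization (J : finType)
    (P : set (discrete_topology J * discrete_topology J)) (hP : tournament P) :
   exists (X : topologicalType) (R : set (X * X)) (C : set X),
     let F := limit_point (@isolated_points X) in
     [/\ arc_cyclic R /\ prime_tournament R, cantor_subset C,
         countable (@isolated_points X),
         finite_set F /\ F `<=` C & isomorphic (@restr X R F) P].
Proof.
have cQ : compact [set: cantor1] := one_point_compactification_compact.
have iN : @isolated_points cantor1 None by exact/isolated_cantor1.
have hF (u : blowup J cantor1) :
    limit_point (@isolated_points _) u <-> u.2 = None.
  case: u => i [[n x]|]; split => //=.
    by move=> /limit_isolated_prod /limit_isolated_tower_level /limit_isolated_cantor1.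
  by move=> _; apply/limit_isolated_prod; exact: limit_isolated_tower_top iN.
have x0 : cantor1 := None.
pose A : set (tower cantor1) := [set v | forall n x, v = Some (n, x) -> range Some x].
exists (blowup J cantor1), (rel_of (blowup_arc P cantor1_arc cantor1_sign)),
  [set u | A u.2] => F.
have [j0 _] := tournament_point hP.
split.
- split; first exact: (blowup_arc_cyclic hP cQ cantor1_signed x0 cantor1_sign_cyclic).
  exact: (blowup_prime hP cQ cantor1_signed x0 cantor1_sign_simple).
- apply: cantor_subset_image.
    exact: orientation_hausdorff (blowup_orientation hP cQ cantor1_signed x0).
  exact/(cantor_image_prod j0)/(cantor_image_tower cQ)/cantor_image_some.
- pose f (u : J * nat) : blowup J cantor1 := (u.1, Some (u.2, None)).
  apply: (@sub_countable _ _ _ (range f)).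
    apply: subset_card_le => -[i [[n x]|]] /isolated_prod.
      by move=> /isolated_tower_level /isolated_cantor1 ->; exists (i, n).
    by move=> /(not_isolated_tower_top cQ None).
  exact: sub_countable (card_image_le _ _) (countableP _).
- split; first exact (finite_tower_tops hF).
  by move=> u /hF u2 n x; rewrite u2.
- exact (restr_blowup hP _ _ hF).
Qed.

Section Level.
Variables (E : topologicalType).
Hypotheses (cE : compact [set: E]).

Definition level (u : tower E) : Nstar := omap fst u.

Lemma level_continuous : continuous level.
Proof.
move=> [[n x]|] U.
  move=> /nbhs_singleton Un; apply/nbhs_tower_level.
  by apply: filterS (@filterT _ (nbhs x) _) => y _.
move=> [W [cW _] WU]; exists (W `*` setT).
  split; first exact: compact_setX cW cE.
  rewrite -[X in closed X]/(_ `*` _) setXT.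
  apply: (@closed_comp _ _ fst); last exact: discrete_closed.
  by move=> x _; exact: cvg_fst.
by move=> _ [[[n x] nW <-]|->]; apply: WU; [left; exists n => // Wn; exact: nW | right].
Qed.
End Level.

(** A tower of towers: the tops of the inner towers converge to the outer top, and
since they are positive the arcs of the outer tower between them are those of
[L1]. *)
Lemma L1_realization :
   exists (X : topologicalType) (R : set (X * X)) (C : set X),
     let F := limit_point (@isolated_points X) in
     [/\ arc_cyclic R /\ prime_tournament R, cantor_subset C,
         countable (@isolated_points X),
         F `<=` C /\ F #= [set: nat] & isomorphic (@restr X R F) L1].
Proof.
have cQ : compact [set: cantor1] := one_point_compactification_compact.
have cT := @compact_tower cantor1.
have iN : @isolated_points cantor1 None by exact/isolated_cantor1.
have x0 : cantor1 := None.
have sT := tower_signed cQ cantor1_signed x0.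
have oT := tower_orientation cT sT.
have hF (u : tower (tower cantor1)) : limit_point (@isolated_points _) u <->
    u = None \/ exists n, u = Some (n, None).
  case: u => [[n [[m x]|]]|].
  - split; last by case=> // -[].
    move=> /limit_isolated_tower_level /limit_isolated_tower_level.
    by move=> /limit_isolated_cantor1.
  - split=> _; first by right; exists n.
    by apply/limit_isolated_tower_level; exact: limit_isolated_tower_top iN.
  - split=> _; first by left.
    apply: (limit_isolated_tower_top cT (x := Some (0, None))).
    by apply/isolated_tower_level.
pose A : set (tower cantor1) := [set v | forall n x, v = Some (n, x) -> range Some x].
exists (tower (tower cantor1)),
  (rel_of (tower_arc (tower_arc cantor1_arc cantor1_sign) (@tower_sign cantor1))),
  [set u | forall n x, u = Some (n, x) -> A x] => F.
have sT_simple : sign_simple (tower_arc cantor1_arc cantor1_sign) (@tower_sign cantor1).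
  move=> B mB sB u v Bu Bv; apply: contrapT => nuv.
  have BT := tower_simple cQ cantor1_signed cantor1_sign_simple mB Bu Bv nuv.
  have [w sw _] := signed_nbr sT u true.
  have Bw : B w by rewrite BT.
  by have := sB _ _ Bu Bw; rewrite sw; case: (tower_sign u).
have sT_cyclic : sign_cyclic (tower_arc cantor1_arc cantor1_sign) (@tower_sign cantor1).
  by move=> u v _; exact: (tower_cyclic cQ cantor1_signed cantor1_sign_cyclic).
have Fval (u : F) : set_val u = None \/ exists n, set_val u = Some (n, None).
  by case: u => u Fu; rewrite set_valE /=; apply/hF; exact: set_mem.
split.
- split; first exact: (arc_cyclic_rel_of oT (tower_cyclic cT sT sT_cyclic)).
  apply: (prime_rel_of oT (x := None) (y := Some (0, None))) => //.
    exact: compact_tower.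
  exact: (tower_simple cT sT sT_simple).
- apply: cantor_subset_image; first exact: orientation_hausdorff oT.
  exact/(cantor_image_tower cT)/(cantor_image_tower cQ)/cantor_image_some.
- pose f (u : nat * nat) : tower (tower cantor1) := Some (u.1, Some (u.2, None)).
  apply: (@sub_countable _ _ _ (range f)).
    apply: subset_card_le => -[[n [[m x]|]]|].
    + move=> /isolated_tower_level /isolated_tower_level /isolated_cantor1 ->.
      by exists (n, m).
    + by move=> /isolated_tower_level /(not_isolated_tower_top cQ None).
    + by move=> /(not_isolated_tower_top cT None).
  exact: sub_countable (card_image_le _ _) (countableP _).
- split.
    by move=> u /hF[->|[n ->]] m x // [_ <-].
  apply: (@card_eq_nat _ (option nat) _ (omap (fun n => (n, None)))
    (fun n => Some (n, None)) (fun u => if u is Some (n, _) then n else 0)) => //.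
    by move=> u /hF[->|[n ->]]; [exists None | exists (Some n)].
  by move=> n; apply/hF; right; exists n.
- exists (fun u : F => level (set_val u)); split; last first.
    move=> u v uv; apply: val_inj; rewrite !set_valE in uv *.
    have := Fval u; have := Fval v; rewrite !set_valE.
    by move: uv; case: (\val u) (\val v) => [[n x]|] [[m y]|] //= [<-]
      [|[k]] // [_ ->] [|[l]] // [_ ->].
  split.
  + move=> u; apply: continuous_comp; last exact: level_continuous.
    exact: (@initial_continuous F _ set_val).
  + apply/seteqP; split => // v _.
    pose u : tower (tower cantor1) := omap (fun n => (n, None)) v.
    have Fu : u \in F.
      rewrite inE; apply/hF; rewrite /u.
      by case: v {u} => [n|]; [right; exists n | left].
    by exists (exist _ u Fu) => //=; rewrite set_valE /= /u; case: v {u Fu}.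
  + move=> _ [[u v] uv <-] /=; move: uv; rewrite /restr /rel_of /L1 /=.
    case=> [->|]; first by left.
    case: (Fval u) (Fval v) => [->|[n ->]] [->|[m ->]] //= uv; first by right.
    right => /=; rewrite !addn1; move: uv; rewrite /tower_arc.
    case: (ltngtP n m) => nm //=.
      by case: eqVneq => // mn _; right; rewrite ltn_neqAle eq_sym mn.
    by case: eqVneq => // -> _; left.
Qed.

Lemma cycle_point_rel_of (X : topologicalType) (c : X -> X -> bool) (x : X) :
  orientation c ->
  (forall U, nbhs x U -> exists y z, [/\ U y, U z, c x y, c y z & c z x]) ->
  cycle_point (rel_of c) x.
Proof.
move=> oc h U Ux; have [y [z [Uy Uz cxy cyz czx]]] := h U Ux.
exists [set x; y; z]; split; first exact: three_cycle_rel_of.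
  by left; left.
by move=> u [[]|] -> //; exact: nbhs_singleton.
Qed.

(** The levels are two copies of the Cantor tournament with all arcs from the first
to the second, without twist.  An arc between the copies whose ends have the same
sign is seen identically from all other levels and fibres, and a vertex of its own level
would need an arc from the second copy to the first; so it lies in no 3-cycle.
Such arcs exist on all levels, hence in every neighbourhood of a top;
but inside one copy every arc lies in a 3-cycle. *)
Lemma exceptional_points_realization (J : finType)
    (P : set (discrete_topology J * discrete_topology J)) (hP : tournament P) :
   exists (X : topologicalType) (R : set (X * X)),
     let F := exceptional_points R in
     [/\ almost_locally_arc_cyclic R, wac R, prime_tournament R,
         is_cantor X & isomorphic (@restr X R F) P].
Proof.
pose E : topologicalType := (discrete_topology bool * cantor_space)%type.
pose q (i j : bool) := ~~ i && j.
have q_asym i j : i <> j -> q j i = ~~ q i j by case: i j => [] [].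
pose c : E -> E -> bool := prod_arc q false cantor_arc cantor_sign.
pose s : E -> bool := prod_sign cantor_sign.
have cE : compact [set: E] := compact_prod_discrete (J := bool) cantor_space_compact.
have sE : signed c s := prod_signed false q_asym cantor_signed.
have ssE : sign_simple c s := prod_sign_simple cantor_signed cantor_sign_simple.
pose y0 : cantor_space := fun=> true.
pose x0 : E := (true, y0).
pose b := blowup_arc P c s.
have ob : orientation b := blowup_orientation hP cE sE x0.
have [j0 _] := tournament_point hP.
exists (blowup J E), (rel_of b) => F.
have bfib j n i x y : b (j, Some (n, (i, x))) (j, Some (n, (i, y))) = cantor_arc x y.
  by rewrite /b /blowup_arc prod_arc_fiber tower_arc_fiber /c prod_arc_fiber.
have hF u : F u <-> u.2 = None.
  case: u => j [[n [i x]]|]; split => //=.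
    case; exists [set u | exists y, u = (j, Some (n, (i, y)))].
      apply/nbhs_prod_discrete/nbhs_tower_level/nbhs_prod_discrete.
      by apply: filterS (@filterT _ (nbhs x) _) => y _; exists y.
    move=> _ _ [y ->] [z ->] /(strict_rel_of ob); rewrite bfib => yz.
    have [w zw wy] := cantor_cyclic yz.
    by exists (j, Some (n, (i, w))); apply: (three_cycle_rel_of ob); rewrite bfib.
  move=> _ [U /nbhs_prod_discrete /(nbhs_tower_top cE)[_ [N NU]] acU].
  (* An arc between the two copies whose ends have the same sign. *)
  pose u k : blowup J E := (j, Some (N, (k, y0))).
  have cuv : b (u false) (u true).
    by rewrite /b /blowup_arc prod_arc_fiber tower_arc_fiber /c prod_arc_cross.
  have [|||[k w] /(three_cycle_inv ob cuv)[cvw cwu]] := acU (u false) (u true).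
  - exact: (NU N (false, y0)).
  - exact: (NU N (true, y0)).
  - exact/(strict_rel_of ob).
  have nuw : u false <> (k, w) by exact/nesym/(arc_neq ob).
  have cuw : b (u false) (k, w) = false.
    by rewrite (orient_asym ob (nesym nuw)) cwu.
  suff : b (u false) (k, w) = b (u true) (k, w) by rewrite cuw cvw.
  have [jk|jk] := pselect (j = k); last first.
    by rewrite /b /blowup_arc !prod_arc_cross.
  subst k; move: cvw cwu; rewrite /b /blowup_arc !prod_arc_fiber.
  case: w {nuw cuw} => [[n [i z]]|] //.
  have [<-|Nn] := eqVneq N n; last first.
    by rewrite /tower_arc (negbTE Nn).
  by rewrite !tower_arc_fiber /c; case: i; rewrite /prod_arc.
split.
- exact (finite_tower_tops hF).
- split.
    apply: (compact_tournament_rel_of ob (j0, None)).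
    exact: compact_prod_discrete (@compact_tower E).
  move=> [j [[n [i x]]|]] _; apply: (cycle_point_rel_of ob) => U /nbhs_prod_discrete.
    move=> /nbhs_tower_level /nbhs_prod_discrete /prefix_basis[m mU].
    pose y := flip_at x m (x m (+) x m.+1).
    have d : diverge_at x y m := diverge_at_flip _ _ _.
    have cxy : cantor_arc x y.
      by rewrite cantor_arc_flip; case: (x m) (x m.+1) => [] [].
    have [z [zx cyz czx]] := cantor_cyclic_local d cxy.
    exists (j, Some (n, (i, y))), (j, Some (n, (i, z))); rewrite !bfib; split => //.
      by apply: mU => k km; case: d => e _; rewrite e.
    by apply: mU => k km; apply: zx; exact: ltnW.
  move=> /(nbhs_tower_top cE)[_ [N NU]].
  have [y sy _] := signed_nbr sE x0 true.
  have [z sz cyz] := signed_nbr sE y true.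
  exists (j, Some (N, y)), (j, Some (N, z)).
  split; [exact: NU|exact: NU| | |]; rewrite /b /blowup_arc prod_arc_fiber.
  - by rewrite /tower_arc /= sy.
  - by rewrite tower_arc_fiber.
  - by rewrite /tower_arc /= sz sy.
- exact: (blowup_prime hP cE sE x0 ssE).
- apply: is_cantor_image; first exact: orientation_hausdorff ob.
  have := cantor_image_prod true cantor_image_id.
  move=> /(cantor_image_tower cE)/(cantor_image_prod j0).
  by congr cantor_image; apply/seteqP; split.
- exact (restr_blowup hP _ _ hF).
Qed.

Theorem theorem13p12 (J : finType)
    (P : set (discrete_topology J * discrete_topology J)) (hP : tournament P) :
  [/\
   (* (a) *)
   exists (X : topologicalType) (R : set (X * X)),
     let F := ~` @isolated_points X in
     [/\ arc_cyclic R, prime_tournament R, [set: X] #= [set: nat],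
         finite_set F & isomorphic (@restr X R F) P],
   (* (b) *)
   exists (X : topologicalType) (R : set (X * X)) (C : set X),
     let F := limit_point (@isolated_points X) in
     [/\ arc_cyclic R /\ prime_tournament R, cantor_subset C,
         countable (@isolated_points X),
         finite_set F /\ F `<=` C & isomorphic (@restr X R F) P],
   (* (c) *)
   exists (X : topologicalType) (R : set (X * X)) (C : set X),
     let F := limit_point (@isolated_points X) in
     [/\ arc_cyclic R /\ prime_tournament R, cantor_subset C,
         countable (@isolated_points X),
         F `<=` C /\ F #= [set: nat] & isomorphic (@restr X R F) L1] &
   (* (d) *)
   exists (X : topologicalType) (R : set (X * X)),
     let F := exceptional_points R in
     [/\ almost_locally_arc_cyclic R, wac R, prime_tournament R,
         is_cantor X & isomorphic (@restr X R F) P]].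
Proof.
split.
- exact: countable_realization.
- exact: cantor_with_isolated_points_realization.
- exact: L1_realization.
- exact: exceptional_points_realization.
Qed.
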